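(* Let $m,n\geq1$ with $m=2$ or $n=2$, let $A\in\mathbb{M}_{m\times n}(\mathbb{C})$, and let $\mathcal{M}$ be a subspace of $\mathbb{M}_{m\times n}(\mathbb{C})$. For $1<p<\infty$ let $Y_p\in\mathcal{M}$ be the $c_p$-approximation of $A$, and let $Y^{(st)}\in\mathcal{M}$ be the strict spectral approximation of $A$. Then $$Y_p\to Y^{(st)}\quad\text{as }p\to\infty.$$
   Context: $\mathbb{M}_{m\times n}(\mathbb{C})$ is the space of complex $m\times n$ matrices, $n_0=\min\{m,n\}$, and $\boldsymbol{\sigma}(A)=(\sigma_1(A),\ldots,\sigma_{n_0}(A))$ is the vector of singular values of $A$ in nonincreasing order. For $1\le p<\infty$ the Schatten $p$-norm ($c_p$ norm) is $\|A\|_p=(\sum_{i=1}^{n_0}\sigma_i^p(A))^{1/p}$. For $1<p<\infty$ the $c_p$ norm is strictly convex, so there is a unique $Y_p\in\mathcal{M}$ with $\|A-Y_p\|_p=\min_{X\in\mathcal{M}}\|A-X\|_p$; it is called the $c_p$-approximation of $A$. The strict spectral approximation $Y^{(st)}$ of $A$ is the (known to exist and be unique) matrix in $\mathcal{M}$ for which $\boldsymbol{\sigma}(A-Y^{(st)})$ is minimal in the lexicographic ordering on the set $\{\boldsymbol{\sigma}(A-Y):Y\in\mathcal{M}\}$. Subspace means complex linear subspace. *)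

(* Defs.v *)
From HB Require Import structures.
From mathcomp Require Import all_boot all_order all_algebra.
From mathcomp Require Import complex.
From mathcomp Require Import all_classical all_reals all_analysis.

Set Implicit Arguments.
Unset Strict Implicit.
Unset Printing Implicit Defensive.

Import Order.TTheory GRing.Theory Num.Theory numFieldNormedType.Exports.

Local Open Scope ring_scope.
Local Open Scope sesquilinear_scope.

(* The usual topology of the complex plane, given by the modulus. MathComp-
   Analysis puts it on [R[i]^o] only; matrices over [R[i]] then carry the
   topology of entrywise convergence. *)
HB.instance Definition _ (R : realType) :=
  PseudoPointedMetric.copy R[i] (R[i]^o).

Section Defs.
Variable R : realType.

(* [spectral_diag] lists the [n] eigenvalues of the Hermitian positive
   semidefinite matrix [A^* A], with multiplicity and in no specified order.
   When [m < n], at least [n - m] of them are zero, and the last [n - m] entries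
   of the sorted sequence are dropped. *)
Definition singvals m n (A : 'M[R[i]]_(m, n)) : (minn m n).-tuple R :=
  let s := sort >=%R [seq Num.sqrt (complex.Re (spectral_diag (A ^t* *m A) 0 j))
                     | j <- enum 'I_n] in
  [tuple s`_i | i < minn m n].

Definition schatten (p : R) m n (A : 'M[R[i]]_(m, n)) : R :=
  (\sum_(i < minn m n) tnth (singvals A) i `^ p) `^ p^-1.

Definition cp_approx (p : R) m n (A : 'M[R[i]]_(m, n))
    (M : {vspace 'M[R[i]]_(m, n)}) (Y : 'M[R[i]]_(m, n)) : Prop :=
  Y \in M /\ forall X : 'M[R[i]]_(m, n), X \in M ->
    schatten p (A - Y) <= schatten p (A - X).

(* [<=] is the lexicographic order carried by the alias [tuplelexi]. *)
Definition strict_spectral_approx m n (A : 'M[R[i]]_(m, n))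
    (M : {vspace 'M[R[i]]_(m, n)}) (Y : 'M[R[i]]_(m, n)) : Prop :=
  Y \in M /\ forall X : 'M[R[i]]_(m, n), X \in M ->
    ((singvals (A - Y) : (minn m n).-tuplelexi R)
       <= (singvals (A - X) : (minn m n).-tuplelexi R))%O.

End Defs.

(* Main.v *)
(* With two singular values s >= t, write B_p = A - Y_p and (s, t) for the
   singular values of A - Yst. Minimality of s gives s <= s(B_p), so the
   inequality s(B_p)^p + t(B_p)^p <= s^p + t^p forces t(B_p) <= t and
   s(B_p)^p <= 2 s^p; hence s(B_p) -> s. By compactness it remains to see that
   a cluster point Z of Y_p equals Yst. It satisfies s(A - Z) <= s and
   ||A - Z||_2^2 <= s^2 + t^2. If Z and Yst differed, then for their midpoint X the
   residual A - X would still have largest singular value at most s, but a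
   Frobenius norm strictly smaller than that of A - Yst, contradicting the
   lexicographic minimality of Yst.
   When min(m, n) = 1 the same argument runs with t = 0. *)

Require Import Defs.
From mathcomp Require Import all_boot all_order all_algebra.
From mathcomp Require Import complex.
From mathcomp Require Import all_classical all_reals all_analysis.
From mathcomp Require Import ring lra.

Import Order.TTheory GRing.Theory Num.Theory numFieldNormedType.Exports.

Local Open Scope ring_scope.
Local Open Scope classical_set_scope.
Local Open Scope sesquilinear_scope.

(** * Squared Frobenius norm *)

(** The squared modulus is valued in [R] rather than [R[i]], so that norms are compared in a total
    order and polynomial identities fall to [ring]. *)
Definition sqmod {R : realType} (z : R[i]) : R :=
  complex.Re z ^+ 2 + complex.Im z ^+ 2.

Lemma sqmodE {R : realType} (z : R[i]) : (sqmod z)%:C%C = z^* * z.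
Proof.
case: z => a b; apply/eqP; rewrite /sqmod eq_complex /=.
by apply/andP; split; apply/eqP; ring.
Qed.

Definition sqfrob {R : realType} {m n} (B : 'M[R[i]]_(m, n)) : R :=
  \sum_i \sum_j sqmod (B i j).

Lemma sqmod_ge0 {R : realType} (z : R[i]) : 0 <= sqmod z.
Proof. by rewrite addr_ge0 ?sqr_ge0. Qed.

Lemma sqfrob_ge0 {R : realType} {m n} (B : 'M[R[i]]_(m, n)) : 0 <= sqfrob B.
Proof. by do 2!apply: sumr_ge0 => ? _; exact: sqmod_ge0. Qed.

Lemma sqfrob_eq0 {R : realType} {m n} (B : 'M[R[i]]_(m, n)) :
  sqfrob B = 0 -> B = 0.
Proof.
move=> /psumr_eq0P B0; apply/matrixP => i j; rewrite mxE.
have := B0 (fun i _ => sumr_ge0 _ (fun j _ => sqmod_ge0 (B i j))) i isT.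
move=> /psumr_eq0P/(_ j isT) Bij; apply/eqP; rewrite eq_complex /=.
have /eqP : sqmod (B i j) = 0 by apply: Bij => k _; exact: sqmod_ge0.
by rewrite paddr_eq0 ?sqr_ge0// !sqrf_eq0.
Qed.

(** The source of strict convexity: it makes the midpoint of two distinct residuals strictly better,
    and it also bounds [Y p] in terms of [A] and [A - Y p]. *)
Lemma sqfrob_parallelogram {R : realType} {m n} (B C : 'M[R[i]]_(m, n)) :
  sqfrob (B + C) + sqfrob (B - C) = 2 * (sqfrob B + sqfrob C).
Proof.
rewrite /sqfrob -!big_split /= mulr_sumr; apply: eq_bigr => i _.
rewrite -!big_split /= mulr_sumr; apply: eq_bigr => j _.
by rewrite !mxE; case: (B i j) (C i j) => a b [c d]; rewrite /sqmod /=; ring.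
Qed.

Lemma sqfrobZ {R : realType} {m n} (a : R) (B : 'M[R[i]]_(m, n)) :
  sqfrob (a%:C%C *: B) = a ^+ 2 * sqfrob B.
Proof.
rewrite /sqfrob mulr_sumr; apply: eq_bigr => i _.
rewrite mulr_sumr; apply: eq_bigr => j _.
by rewrite !mxE; case: (B i j) => b c; rewrite /sqmod /=; ring.
Qed.

Lemma sqfrob0 {R : realType} m n : sqfrob (0 : 'M[R[i]]_(m, n)) = 0.
Proof. by have := @sqfrobZ R m n 0 0; rewrite scaler0 expr0n mul0r. Qed.

Lemma sqfrob_tr {R : realType} {m n} (B : 'M[R[i]]_(m, n)) :
  (sqfrob B)%:C%C = \tr (B ^t* *m B).
Proof.
rewrite /sqfrob rmorph_sum /mxtrace.
under eq_bigr do rewrite rmorph_sum /=.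
rewrite exchange_big; apply: eq_bigr => j _; rewrite mxE.
by apply: eq_bigr => i _; rewrite sqmodE !mxE.
Qed.

Lemma trmxC_mul {F : numClosedFieldType} {m n p} (B : 'M[F]_(m, n))
    (C : 'M[F]_(n, p)) :
  (B *m C) ^t* = C ^t* *m B ^t*.
Proof. by rewrite trmx_mul map_mxM. Qed.

Lemma sqfrob_unitary {R : realType} {n p} (U : 'M[R[i]]_n) (B : 'M[R[i]]_(n, p)) :
  U \is unitarymx -> sqfrob (U *m B) = sqfrob B.
Proof.
move=> Uu; apply: complexI; rewrite !sqfrob_tr trmxC_mul mulmxA -(mulmxA _ _ U).
by rewrite -(invmx_unitary Uu) mulVmx ?mulmx1 // unitarymx_unit.
Qed.

(** The columns of [W] are orthogonal, so no cross terms survive. Below, [y] holds the coordinates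
    of a vector in an eigenbasis of the Gram matrix. *)
Lemma sqfrob_diag {R : realType} {m n} (e : 'I_n -> R) (W : 'M[R[i]]_(m, n))
    (y : 'cV[R[i]]_n) :
  W ^t* *m W = diag_mx (\row_j (e j)%:C%C) ->
  sqfrob (W *m y) = \sum_j e j * sqmod (y j 0).
Proof.
move=> WW; apply: complexI; rewrite sqfrob_tr trmxC_mul mulmxA -(mulmxA _ _ W) WW.
rewrite /mxtrace big_ord1 mxE rmorph_sum; apply: eq_bigr => j _.
by rewrite mul_mx_diag !mxE rmorphM /= sqmodE; ring.
Qed.

(** * Singular values *)

Lemma gram_spectral {R : realType} {m n} (B : 'M[R[i]]_(m, n))
    (e := fun j => complex.Re (spectral_diag (B ^t* *m B) 0 j))
    (W := B *m spectralmx (B ^t* *m B) ^t*) :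
  W ^t* *m W = diag_mx (\row_j (e j)%:C%C) /\ forall j, e j = sqfrob (col j W).
Proof.
set G := B ^t* *m B in e W *.
have Gh : G \is hermsymmx.
  by apply/is_hermitianmxP; rewrite expr0 scale1r /G trmxC_mul trmxCK.
(* Only real parts of eigenvalues enter [singvals]; as [G] is Hermitian, nothing is lost. *)
have dE : spectral_diag G = \row_j (e j)%:C%C.
  apply/rowP => j; rewrite mxE RRe_real //.
  exact: (mxOverP (hermitian_spectral_diag_real Gh)).
have /orthomx_spectralP GE := hermitian_normalmx Gh.
have WW : W ^t* *m W = diag_mx (\row_j (e j)%:C%C).
  rewrite /W trmxC_mul trmxCK mulmxA -(mulmxA _ _ B) -/G -dE.
  have Uu := spectral_unitarymx G; rewrite -(invmx_unitary Uu) {2}GE.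
  rewrite -!mulmxA mulmxV ?spectral_unit // mulmx1.
  by rewrite mulmxA mulmxV ?spectral_unit // mul1mx.
split => // j; apply: complexI; rewrite sqfrob_tr /mxtrace big_ord1.
transitivity ((W ^t* *m W) j j); first by rewrite WW !mxE eqxx.
by rewrite !mxE; apply: eq_bigr => i _; rewrite !mxE.
Qed.

(** The columns of [W] with nonzero diagonal entry have an invertible Gram matrix, which factors
    through dimension [m] and so has rank at most [m]. *)
Lemma card_gram_diag {F : numClosedFieldType} {m n} (W : 'M[F]_(m, n))
    (d : 'rV[F]_n) :
  W ^t* *m W = diag_mx d -> (#|[pred j | (d 0 j != 0)%R]| <= m)%N.
Proof.
move=> WW; set S := [pred j | _].
pose f : 'I_#|S| -> 'I_n := enum_val.
have : (\rank ((colsub f W) ^t* *m colsub f W) <= m)%N by exact: mulmx_max_rank.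
suff -> : (colsub f W) ^t* *m colsub f W = diag_mx (\row_j d 0 (f j)).
  rewrite mxrank_unit // unitmxE det_diag unitfE prodf_seq_neq0.
  by apply/allP => j _; rewrite mxE; have := enum_valP j; rewrite inE.
apply/matrixP => i j; have := congr1 (fun X : 'M[F]_n => X (f i) (f j)) WW.
rewrite !mxE (inj_eq enum_val_inj) => <-.
by apply: eq_bigr => k _; rewrite !mxE.
Qed.

Section Singvals.
Context {R : realType} {m n : nat} (B : 'M[R[i]]_(m, n)).

Let e j := complex.Re (spectral_diag (B ^t* *m B) 0 j).
Let U := spectralmx (B ^t* *m B).
Let W := B *m U ^t*.
Let s := sort >=%R [seq Num.sqrt (e j) | j <- enum 'I_n].

Let Uu : U \is unitarymx. Proof. exact: spectral_unitarymx. Qed.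
Let WW : W ^t* *m W = diag_mx (\row_j (e j)%:C%C).
Proof. by have [] := gram_spectral B. Qed.
Let e_ge0 j : 0 <= e j.
Proof. by have [_ eE] := gram_spectral B; rewrite /e eE; exact: sqfrob_ge0. Qed.
Let BE : B = W *m U.
Proof. by rewrite /W -(invmx_unitary Uu) mulmxKV // spectral_unit. Qed.

Let size_s : size s = n.
Proof. by rewrite size_sort size_map size_enum_ord. Qed.

Let s_ge0 i : 0 <= s`_i.
Proof.
have [lt_in|] := ltnP i (size s); last by move=> /(nth_default 0)->.
by have := mem_nth 0 lt_in; rewrite mem_sort => /mapP[j _ ->]; exact: sqrtr_ge0.
Qed.

Let s_sorted i j : (i <= j)%N -> s`_j <= s`_i.
Proof.
move=> le_ij; have [lt_jn|] := ltnP j (size s); last by move=> /(nth_default 0)->.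
apply: (@sorted_leq_nth _ >=%R _ _ 0 s) => //; last first.
- by rewrite inE (leq_ltn_trans le_ij).
- apply: sort_sorted => x y; exact: ge_total.
- by move=> x /=.
- by move=> x y z /= xy yz; exact: le_trans yz xy.
Qed.

(** Truncating to [minn m n] entries thus drops only zeros. A positive entry at [i] would make the
    first [i + 1 > m] entries positive, more than the rank of the Gram matrix allows. *)
Let s_tail i : (m <= i)%N -> s`_i = 0.
Proof.
move=> le_mi; apply/eqP/negPn/negP => si0.
have si_gt0 : 0 < s`_i by rewrite lt0r si0 s_ge0.
have := card_gram_diag W _ WW; rewrite leqNgt => /negP; apply.
have lt_in : (i < size s)%N.
  by rewrite ltnNge; apply/negP => /(nth_default 0) sE; rewrite sE eqxx in si0.
rewrite (leq_trans (leq_ltn_trans le_mi (ltnSn i))) //.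
have -> : #|[pred j | (\row_k (e k)%:C%C) 0 j != 0]| =
    count (fun x => 0 < x) s.
  rewrite count_sort count_map -sum1_count big_enum_cond.
  rewrite -sum1_card; apply: eq_bigl => j.
  by rewrite !inE mxE sqrtr_gt0 lt0r e_ge0 andbT -(inj_eq (@complexI R)).
rewrite -(cat_take_drop i.+1 s) count_cat (leq_trans _ (leq_addr _ _)) //.
have : all (fun x => 0 < x) (take i.+1 s).
  apply/(all_nthP 0) => k; rewrite size_takel // ltnS => le_ki.
  by rewrite nth_take ?ltnS // (lt_le_trans si_gt0) // s_sorted.
by rewrite all_count => /eqP ->; rewrite size_takel.
Qed.

(** Past [minn m n] the left side is the default 0; the right side is 0 by [s_tail] if [m <= i], and
    by the end of the list if [n <= i]. *)
Lemma singvals_nth i : (singvals B)`_i = s`_i.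
Proof.
have [lt_i|ge_i] := ltnP i (minn m n).
  by have := tnth_nth 0 (singvals B) (Ordinal lt_i); rewrite tnth_mktuple.
rewrite nth_default ?size_tuple //; move: ge_i; rewrite geq_min => /orP[].
  by move=> /s_tail ->.
by move=> le_ni; rewrite nth_default // size_s.
Qed.

Lemma singvals_ge0 i : 0 <= (singvals B)`_i.
Proof. by rewrite singvals_nth. Qed.

Lemma singvals_nonincreasing i j : (i <= j)%N -> (singvals B)`_j <= (singvals B)`_i.
Proof. by rewrite !singvals_nth; exact: s_sorted. Qed.

(** Both sides are the trace of the Gram matrix. The sum is first padded with zeros to all [n]
    eigenvalues, where the sorting can be undone. *)
Lemma singvals_sqfrob : \sum_(i < minn m n) (singvals B)`_i ^+ 2 = sqfrob B.
Proof.
have -> : \sum_(i < minn m n) (singvals B)`_i ^+ 2 = \sum_(i < n) s`_i ^+ 2.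
  rewrite (big_ord_widen n (fun i => (singvals B)`_i ^+ 2)) ?geq_minr //.
  rewrite [RHS](bigID (fun i : 'I_n => (i < minn m n)%N)) /=.
  rewrite [X in _ + X]big1 ?addr0; first by apply: eq_bigr => i; rewrite singvals_nth.
  move=> i; rewrite -leqNgt -singvals_nth => le_i.
  by rewrite nth_default ?expr0n ?size_tuple.
have -> : \sum_(i < n) s`_i ^+ 2 = \sum_(x <- s) x ^+ 2.
  by rewrite (big_nth 0) size_s big_mkord.
rewrite (perm_big _ (permEl (perm_sort _ _))) big_map big_enum /=.
apply: complexI; rewrite sqfrob_tr BE trmxC_mul mulmxA -(mulmxA _ _ W) WW.
rewrite mxtrace_mulC mulmxA -(invmx_unitary Uu) mulmxV ?spectral_unit // mul1mx.
rewrite mxtrace_diag rmorph_sum; apply: eq_bigr => j _.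
by rewrite mxE sqr_sqrtr.
Qed.

(** The largest singular value as an operator norm. For each fixed [x] the inequality is closed in
    [B] and stable under midpoints, which stands in for continuity and convexity of singular
    values. *)
Lemma singvals0_le (c : R) : (0 < n)%N -> 0 <= c ->
  (singvals B)`_0 <= c <->
  forall x : 'cV[R[i]]_n, sqfrob (B *m x) <= c ^+ 2 * sqfrob x.
Proof.
move=> n_gt0 c_ge0; rewrite singvals_nth; split=> [s0_le x|B_le].
  rewrite -(@sqfrob_unitary _ _ _ U x) // [in leLHS]BE -mulmxA.
  rewrite (sqfrob_diag e W) // /sqfrob mulr_sumr; apply: ler_sum => j _.
  rewrite big_ord1 ler_wpM2r ?sqmod_ge0 // -[e j]sqr_sqrtr //.
  rewrite ler_pXn2r ?nnegrE ?sqrtr_ge0 //.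
  apply: le_trans s0_le.
  have : Num.sqrt (e j) \in s.
    by rewrite mem_sort; apply/mapP; exists j; rewrite ?mem_enum.
  by move=> /(nthP 0)[k _ <-]; exact: s_sorted.
have : s`_0 \in s by rewrite mem_nth // size_s.
rewrite mem_sort => /mapP[j _ ->].
(* The test vector is the unit eigenvector for [e j]; its image is column [j] of [W], of squared
   length [e j]. *)
have /(_ (U ^t* *m delta_mx j 0)) := B_le.
rewrite mulmxA -/W (sqfrob_diag e W) // sqfrob_unitary ?trmxC_unitary //.
have delta k : sqmod (delta_mx j 0 k 0 : R[i]) = (k == j)%:R.
  rewrite mxE eqxx andbT; case: eqP => _;
    by rewrite /sqmod /= !(expr1n, expr0n, addr0).
rewrite (bigD1 j) //= big1 ?addr0 => [|k /negPf kj]; last by rewrite delta kj mulr0.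
rewrite /sqfrob (bigD1 j) //= big_ord1 big1 => [|k /negPf kj]; last first.
  by rewrite big_ord1 delta kj.
rewrite delta eqxx addr0 !mulr1 => /ler_wsqrtr.
by rewrite sqrtr_sqr ger0_norm.
Qed.
End Singvals.

(* Sequences of length at most 2 are read through their entries 0 and 1, an
   absent entry being 0. *)
Lemma big_ord_le2 {V W : nmodType} k (F : V -> W) (s : seq V) :
  (k <= 2)%N -> size s = k -> F 0 = 0 ->
  \sum_(i < k) F s`_i = F s`_0 + F s`_1.
Proof.
move=> k2 sk F0; rewrite -{k}sk in k2 *; case: s k2 => [|a [|b [|? ?]]] // _;
  by rewrite !(big_ord_recr, big_ord0) /= ?F0 ?add0r ?addr0.
Qed.

Lemma lexi_le2 {R : realDomainType} k (s t : k.-tuple R) : (k <= 2)%N ->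
  ((s : k.-tuplelexi R) <= (t : k.-tuplelexi R))%O ->
  s`_0 < t`_0 \/ s`_0 = t`_0 /\ s`_1 <= t`_1.
Proof.
move=> k2; have -> : ((s : k.-tuplelexi R) <= (t : k.-tuplelexi R))%O =
   ((val s : seqlexi R) <= (val t : seqlexi R))%O by [].
case: s t => s /= /eqP ss [t /= /eqP st].
move: k2; rewrite -ss; rewrite -ss in st.
case: s t {ss} st => [|a [|b []]] // [|c [|d []]] //= _ _.
- by right.
- rewrite Order.SeqLexiOrder.Exports.lexi_cons /=.
  by case: (ltgtP a c) => //; [left|move=> ->; right].
rewrite !Order.SeqLexiOrder.Exports.lexi_cons /=.
case: (ltgtP a c) => //; [by left|move=> -> /=].
by case: (ltgtP b d) => //; right.
Qed.

(** * Topology of complex matrices *)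

Lemma continuous_Re {R : realType} : continuous (@complex.Re R : R[i] -> R).
Proof.
move=> z U /= /nbhs_ballP[e e0 eU]; apply/nbhs_ballP; exists e%:C%C => [|w zw] /=.
  by rewrite /= ltcR.
apply: eU; rewrite /ball /= -ltcR; apply: le_lt_trans zw.
by rewrite -raddfB; apply: normc_ge_Re.
Qed.

Lemma continuous_Im {R : realType} : continuous (@complex.Im R : R[i] -> R).
Proof.
move=> z U /= /nbhs_ballP[e e0 eU]; apply/nbhs_ballP; exists e%:C%C => [|w zw] /=.
  by rewrite /= ltcR.
apply: eU; rewrite /ball /= -ltcR; apply: le_lt_trans zw.
(* Up to sign, the imaginary part is the real part after multiplication by ['i], which has modulus
   1. *)
rewrite -raddfB -normrN -ReiNIm; apply: (le_trans (normc_ge_Re _)).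
by rewrite normrM [X in _ * X]normc_def /= expr0n expr1n add0r sqrtr1 mulr1.
Qed.

Lemma continuous_coord {R : realType} {m n} i j :
  continuous (fun B : 'M[R[i]]_(m, n) => B i j).
Proof.
move=> B U /nbhs_ballP[e e0 eU]; apply/nbhs_ballP; exists e => // C [_ BC].
exact/eU/BC.
Qed.

Lemma continuous_sum {T : topologicalType} {R : realType} {I : Type} (r : seq I)
    (f : I -> T -> R) :
  (forall i, continuous (f i)) -> continuous (fun x => \sum_(i <- r) f i x).
Proof.
move=> fc; elim: r => [|i r IHr] x.
  by under eq_fun do rewrite big_nil; exact: cvg_cst.
by under eq_fun do rewrite big_cons; apply: continuousD; [exact: fc|exact: IHr].
Qed.

(** The entries of [L B] are fixed linear combinations of those of [B]. Different choices of [L]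
    give closedness of balls, of subspaces and of the bounds on [(A - B) *m x]. *)
Lemma continuous_sqfrob_affine {R : realType} {m n p q}
    (L : {linear 'M[R[i]]_(m, n) -> 'M[R[i]]_(p, q)}) (C : 'M[R[i]]_(p, q)) :
  continuous (fun B => sqfrob (C + L B)).
Proof.
have ReC k l : continuous (fun B : 'M[R[i]]_(m, n) => complex.Re (B k l)).
  move=> B; apply: (continuous_comp (continuous_coord k l B)).
  exact: continuous_Re.
have ImC k l : continuous (fun B : 'M[R[i]]_(m, n) => complex.Im (B k l)).
  move=> B; apply: (continuous_comp (continuous_coord k l B)).
  exact: continuous_Im.
have LE (B : 'M[R[i]]_(m, n)) i j :
    L B i j = \sum_k \sum_l B k l * L (delta_mx k l) i j.
  rewrite {1}(matrix_sum_delta B) linear_sum summxE.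
  apply: eq_bigr => k _; rewrite linear_sum summxE; apply: eq_bigr => l _.
  by rewrite linearZ mxE.
apply: continuous_sum => i; apply: continuous_sum => j.
have Re_sum I (r : seq I) (F : I -> R[i]) :
  complex.Re (\sum_(k <- r) F k) = \sum_(k <- r) complex.Re (F k).
  exact: (raddf_sum (@complex.Re R)).
have Im_sum I (r : seq I) (F : I -> R[i]) :
  complex.Im (\sum_(k <- r) F k) = \sum_(k <- r) complex.Im (F k).
  exact: (raddf_sum (@complex.Im R)).
have ReM (z w : R[i]) : complex.Re (z * w) =
    complex.Re z * complex.Re w - complex.Im z * complex.Im w.
  by case: z w => a b [c d].
have ImM (z w : R[i]) : complex.Im (z * w) =
    complex.Re z * complex.Im w + complex.Im z * complex.Re w.
  by case: z w => a b [c d] /=; rewrite addrC.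
have LRe : continuous (fun B => complex.Re ((C + L B) i j)).
  pose S (B : 'M[R[i]]_(m, n)) : R := \sum_k \sum_l
    (complex.Re (B k l) * complex.Re (L (delta_mx k l) i j) -
    complex.Im (B k l) * complex.Im (L (delta_mx k l) i j)).
  have Sc : continuous S.
    apply: continuous_sum => k; apply: continuous_sum => l B.
    exact: (cvgB (cvgM (ReC k l B) (cvg_cst _)) (cvgM (ImC k l B) (cvg_cst _))).
  have -> : (fun B => complex.Re ((C + L B) i j)) =
      (fun B => complex.Re (C i j) + S B).
    apply/funext => B; rewrite mxE raddfD /= LE Re_sum; congr (_ + _).
    apply: eq_bigr => k _; rewrite Re_sum; apply: eq_bigr => l _.
    by rewrite ReM.
  by move=> B; apply: cvgD (cvg_cst _) (Sc B).
have LIm : continuous (fun B => complex.Im ((C + L B) i j)).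
  pose S (B : 'M[R[i]]_(m, n)) : R := \sum_k \sum_l
    (complex.Re (B k l) * complex.Im (L (delta_mx k l) i j) +
    complex.Im (B k l) * complex.Re (L (delta_mx k l) i j)).
  have Sc : continuous S.
    apply: continuous_sum => k; apply: continuous_sum => l B.
    exact: (cvgD (cvgM (ReC k l B) (cvg_cst _)) (cvgM (ImC k l B) (cvg_cst _))).
  have -> : (fun B => complex.Im ((C + L B) i j)) =
      (fun B => complex.Im (C i j) + S B).
    apply/funext => B; rewrite mxE raddfD /= LE Im_sum; congr (_ + _).
    apply: eq_bigr => k _; rewrite Im_sum; apply: eq_bigr => l _.
    by rewrite ImM.
  by move=> B; apply: cvgD (cvg_cst _) (Sc B).
move=> B; exact: (cvgD (cvgM (LRe B) (LRe B)) (cvgM (LIm B) (LIm B))).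
Qed.

Lemma closed_sqfrob_affine_le {R : realType} {m n p q}
    (L : {linear 'M[R[i]]_(m, n) -> 'M[R[i]]_(p, q)}) (C : 'M[R[i]]_(p, q)) (c : R) :
  closed [set B | sqfrob (C + L B) <= c].
Proof.
apply: (preimage_closed (f := fun B => sqfrob (C + L B)) (D := [set x | x <= c])).
  by move=> B _; exact: continuous_sqfrob_affine.
exact: closed_le.
Qed.

Lemma closed_sqfrob_sub_le {R : realType} {m n} (A : 'M[R[i]]_(m, n)) (c : R) :
  closed [set B | sqfrob (A - B) <= c].
Proof. exact: (closed_sqfrob_affine_le -%R A c). Qed.

Lemma continuous_sqfrob {R : realType} {m n} :
  continuous (fun B : 'M[R[i]]_(m, n) => sqfrob B).
Proof.
have -> : (fun B : 'M[R[i]]_(m, n) => sqfrob B) = (fun B => sqfrob (0 + idfun B)).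
  by apply/funext => B; rewrite add0r.
exact: continuous_sqfrob_affine.
Qed.

Lemma hausdorff_mx {R : realType} m n : hausdorff_space 'M[R[i]]_(m, n).
Proof.
move=> B C BC; apply/matrixP => i j.
have H := @norm_hausdorff R[i] R[i]^o.
apply: (H (B i j) (C i j)) => U V UB VC.
have [D [UD VD]] := BC _ _ (continuous_coord i j B U UB)
  (continuous_coord i j C V VC).
by exists (D i j).
Qed.

(** The box is the continuous image of a cube of real row vectors listing all real parts, then all
    imaginary parts. *)
Lemma compact_box {R : realType} m n (c : R) :
  compact [set B : 'M[R[i]]_(m, n) | forall i j,
    `|complex.Re (B i j)| <= c /\ `|complex.Im (B i j)| <= c].
Proof.
pose N := (m * n + m * n)%N.
pose f (v : 'rV[R]_N) : 'M[R[i]]_(m, n) := \matrix_(i, j)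
  Complex (v 0 (lshift _ (mxvec_index i j))) (v 0 (rshift _ (mxvec_index i j))).
pose K := [set v : 'rV[R]_N | forall k, `[- c, c]%classic (v 0 k)].
suff <- : f @` K = [set B : 'M[R[i]]_(m, n) | forall i j,
    `|complex.Re (B i j)| <= c /\ `|complex.Im (B i j)| <= c].
  apply: continuous_compact; last first.
    have cK := @rV_compact R N (fun=> `[- c, c]%classic).
    by apply: cK => k; exact: segment_compact.
  apply: continuous_subspaceT => v U /nbhs_ballP[e e0 eU].
  (* Radii of complex balls lie in [R[i]]; positivity forces the imaginary part [e2] to vanish. *)
  case: e => e1 e2 in e0 eU *; move: e0; rewrite /= ltcE /= => /andP[/eqP e20 e0].
  rewrite {e2}e20 in eU *.
  (* Errors below [e1 / 2] in both parts give a squared modulus below [e1 ^+ 2 / 2]. *)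
  apply/nbhs_ballP; exists (e1 / 2); first by rewrite /= divr_gt0.
  move=> w [_ vw]; apply: eU; split=> [|i j]; first by rewrite ltcR.
  rewrite /f !mxE /ball /= normc_def ltcR.
  rewrite /= -[e1]gtr0_norm // -sqrtr_sqr ltr_sqrt ?exprn_gt0 //.
  have := vw 0 (lshift (m * n) (mxvec_index i j)).
  have := vw 0 (rshift (m * n) (mxvec_index i j)).
  rewrite /ball /= !ltr_norml => /andP[b1 b2] /andP[a1 a2]; nra.
apply/seteqP; split => [_ [v Kv <-] i j|B KB].
  have {}Kv k : `|v 0 k| <= c by have := Kv k; rewrite /= in_itv /= ler_norml.
  by rewrite mxE; split; apply: Kv.
exists (row_mx (mxvec (map_mx (@complex.Re R) B))
  (mxvec (map_mx (@complex.Im R) B))).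
  move=> k; rewrite /= in_itv /= -ler_norml; case: (split_ordP k) => l ->;
    case/mxvec_indexP: l => i j; rewrite (row_mxEl, row_mxEr) mxvecE mxE;
    by have [] := KB i j.
apply/matrixP => i j; rewrite mxE row_mxEl row_mxEr !mxvecE !mxE.
by case: (B i j).
Qed.

(** * Approximation with two singular values *)

Lemma singvals2_sqfrob {R : realType} {m n} (B : 'M[R[i]]_(m, n)) :
  (minn m n <= 2)%N ->
  (singvals B)`_0 ^+ 2 + (singvals B)`_1 ^+ 2 = sqfrob B.
Proof.
move=> mn2; rewrite -singvals_sqfrob.
by rewrite (big_ord_le2 _ (fun x => x ^+ 2)) ?size_tuple ?expr0n.
Qed.

Lemma schatten2E {R : realType} {m n} (p : R) (B : 'M[R[i]]_(m, n)) :
  (minn m n <= 2)%N -> p != 0 ->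
  schatten p B = ((singvals B)`_0 `^ p + (singvals B)`_1 `^ p) `^ p^-1.
Proof.
move=> mn2 p0; rewrite /schatten; congr (_ `^ _).
under eq_bigr do rewrite (tnth_nth 0).
by rewrite (big_ord_le2 _ (fun x => x `^ p)) ?size_tuple ?powR0.
Qed.

(** The power sums compare as the norms do. A smaller head for [C] must be offset by its second
    value, itself at most its head; hence the factor 2. *)
Lemma schatten_le_singvals {R : realType} {m n} (p : R) (B C : 'M[R[i]]_(m, n)) :
  (minn m n <= 2)%N -> 0 < p -> schatten p B <= schatten p C ->
  (singvals C)`_0 <= (singvals B)`_0 ->
  (singvals B)`_1 <= (singvals C)`_1 /\
  (singvals B)`_0 `^ p <= 2 * (singvals C)`_0 `^ p.
Proof.
move=> mn2 p_gt0; rewrite !schatten2E ?gt_eqF // => le_BC le_CB0.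
have mono (x y : R) : 0 <= x -> x <= y -> x `^ p <= y `^ p.
  by move=> x0 xy; rewrite ge0_ler_powR ?nnegrE ?(ltW p_gt0) // (le_trans x0).
have smono (x y : R) : 0 <= x -> x < y -> x `^ p < y `^ p.
  by move=> x0 xy; apply: gt0_ltr_powR; rewrite ?nnegrE // (le_trans x0) // ltW.
have {}le_BC : (singvals B)`_0 `^ p + (singvals B)`_1 `^ p <=
    (singvals C)`_0 `^ p + (singvals C)`_1 `^ p.
  rewrite leNgt; apply/negP => lt_CB; move: le_BC; rewrite leNgt => /negP; apply.
  by apply: gt0_ltr_powR; rewrite ?invr_gt0 ?nnegrE ?addr_ge0 ?powR_ge0.
have C0 := singvals_ge0 C; have B0 := singvals_ge0 B.
split.
  rewrite leNgt; apply/negP => /(smono _ _ (C0 1%N)) lt_CB1.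
  by move: le_BC; rewrite leNgt (ler_ltD (mono _ _ (C0 0%N) le_CB0)).
rewrite mulr_natl mulr2n (le_trans _ (le_trans le_BC _)) ?lerDl ?powR_ge0 //.
by rewrite lerD2l (mono _ _ (C0 1%N)) // singvals_nonincreasing.
Qed.

Lemma near_powR_le {R : realType} (d : R) : 0 < d ->
  \forall p \near +oo, forall x y : R, 0 <= x -> 0 <= y ->
    x `^ p <= 2 * y `^ p -> x <= (1 + d) * y.
Proof.
move=> d_gt0; have l_gt0 : 0 < ln (1 + d) by rewrite ln_gt0 // ltrDl.
near=> p => x y x_ge0 y_ge0 le_xy.
have p_gt0 : 0 < p by near: p; exact: nbhs_pinfty_gt.
have lp : 1 <= p * ln (1 + d).
  by rewrite -ler_pdivrMr.
have two_le : 2 <= (1 + d) `^ p.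
  rewrite /powR gt_eqF ?addr_gt0 //; apply: le_trans (expR_ge1Dx _).
  by rewrite -[2]/(1 + 1) lerD2l.
rewrite leNgt; apply/negP => lt_yx.
have /(gt0_ltr_powR p_gt0) := lt_yx.
rewrite !nnegrE x_ge0 mulr_ge0 ?addr_ge0 ?(ltW d_gt0) // => /(_ isT isT).
rewrite powRM ?addr_ge0 ?(ltW d_gt0) // ltNge => /negP; apply.
by apply: le_trans le_xy _; rewrite ler_wpM2r ?powR_ge0.
Unshelve. all: by end_near.
Qed.

Lemma le_from_scaled {R : realFieldType} (x y : R) : 0 <= y ->
  (forall d, 0 < d -> x <= (1 + d) * y) -> x <= y.
Proof.
move=> y_ge0 le_xy; apply/ler_addgt0Pr => e e_gt0.
(* Taking [d = e / (y + 1)] keeps [d * y <= e] and also covers [y = 0]. *)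
have y1 : 0 < y + 1 by rewrite ltr_wpDl.
apply: (le_trans (le_xy (e / (y + 1)) (divr_gt0 e_gt0 y1))).
rewrite mulrDl mul1r lerD2l -mulrA ler_piMr ?ltW //.
by rewrite mulrC ltr_pdivrMr // mul1r ltrDl.
Qed.

(** Here [a] and [b] are the squared norms of a sum and a difference, and [4^-1 * b] is the gain at
    the midpoint. The gain is kept for residuals and dropped for images of a vector. *)
Lemma half_parallelogram_le {R : realFieldType} (a b c d e : R) :
  a + b = 2 * (c + d) -> c <= e -> d <= e -> 2^-1 ^+ 2 * a + 4^-1 * b <= e.
Proof. lra. Qed.

Lemma lexi_sqr_sum_le {R : realFieldType} {x0 x1 y0 y1 fx fy b : R} :
  x0 ^+ 2 + x1 ^+ 2 = fx -> y0 ^+ 2 + y1 ^+ 2 = fy ->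
  x0 = y0 -> 0 <= x1 -> x1 <= y1 -> fy + 4^-1 * b <= fx -> b <= 0.
Proof. by move=> <- <- ->; nra. Qed.

(** Only two non-strict bounds are asked of [Z], because these survive a passage to the limit
    whereas lexicographic minimality need not. *)
Lemma strict_spectral_approx_unique {R : realType} {m n} (A : 'M[R[i]]_(m, n))
    (M : {vspace 'M[R[i]]_(m, n)}) (Y Z : 'M[R[i]]_(m, n)) :
  (minn m n <= 2)%N -> (0 < n)%N -> strict_spectral_approx A M Y -> Z \in M ->
  (singvals (A - Z))`_0 <= (singvals (A - Y))`_0 ->
  sqfrob (A - Z) <= sqfrob (A - Y) -> Z = Y.
Proof.
move=> mn2 n_gt0 [YM Ymin] ZM le0 leF; apply/eqP; rewrite -subr_eq0; apply/eqP.
pose X := (2^-1)%:C%C *: (Z + Y).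
have XM : X \in M by rewrite memvZ // memvD.
have AXE : A - X = (2^-1)%:C%C *: ((A - Z) + (A - Y)).
  have hh : (2^-1)%:C%C + (2^-1)%:C%C = 1 :> R[i].
    by rewrite -rmorphD /= -[2^-1]mul1r -splitr.
  by rewrite addrACA -opprD scalerBr scalerDr -scalerDl hh scale1r.
have F_mid : sqfrob (A - X) + 4^-1 * sqfrob (Z - Y) <= sqfrob (A - Y).
  have ZYE : A - Y - (A - Z) = Z - Y by rewrite opprB addrC addrA subrK.
  rewrite AXE sqfrobZ addrC [A - Z + _]addrC addrC -ZYE.
  exact: half_parallelogram_le _ _ _ _ _ (sqfrob_parallelogram _ _) (lexx _) leF.
have le_mid : (singvals (A - X))`_0 <= (singvals (A - Y))`_0.
  apply/(singvals0_le _ _ n_gt0 (singvals_ge0 _ _)) => x.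
  have Yx := (singvals0_le (A - Y) _ n_gt0 (singvals_ge0 (A - Y) 0)).1 (lexx _) x.
  have Zx := (singvals0_le (A - Z) _ n_gt0 (singvals_ge0 (A - Y) 0)).1 le0 x.
  rewrite AXE -scalemxAl sqfrobZ mulmxDl.
  apply: le_trans (half_parallelogram_le _ _ _ _ _ (sqfrob_parallelogram _ _) Zx Yx).
  by rewrite lerDl mulr_ge0 ?sqfrob_ge0.
apply: sqfrob_eq0; apply: le_anti; rewrite sqfrob_ge0 andbT.
have := lexi_le2 _ _ _ mn2 (Ymin X XM).
rewrite ltNge le_mid => -[//|[eq0 le1]].
exact: lexi_sqr_sum_le (singvals2_sqfrob (A - Y) mn2)
  (singvals2_sqfrob (A - X) mn2) eq0 (singvals_ge0 (A - Y) 1) le1 F_mid.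
Qed.

(** * Closedness, compactness and the passage to the limit *)

Lemma closed_vspace {R : realType} m n (M : {vspace 'M[R[i]]_(m, n)}) :
  closed [set B | B \in M].
Proof.
(* The subspace is the zero set of this map, and vanishing is written as [sqfrob <= 0]. *)
pose L : 'End('M[R[i]]_(m, n)) := (projv M - \1)%VF.
have LE B : L B = projv M B - B by rewrite /L add_lfunE opp_lfunE id_lfunE.
have -> : [set B | B \in M] = [set B | sqfrob (0 + L B) <= 0].
  apply/seteqP; split => B /=; rewrite add0r LE.
    by move=> /projv_id ->; rewrite subrr sqfrob0.
  move=> LB; have /sqfrob_eq0/eqP : sqfrob (projv M B - B) = 0.
    by apply: le_anti; rewrite LB sqfrob_ge0.
  by rewrite subr_eq0 => /eqP <-; exact: memv_proj.
exact: closed_sqfrob_affine_le.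
Qed.

Lemma compact_sqfrob_le {R : realType} m n (c : R) :
  compact [set B : 'M[R[i]]_(m, n) | sqfrob B <= c].
Proof.
(* If [a ^+ 2 <= c] then [|a| <= 1 + a ^+ 2 <= 1 + c], so no square root is needed for the box. *)
apply: (subclosed_compact _ (@compact_box R m n (1 + c))).
  have := @closed_sqfrob_affine_le R m n m n idfun 0 c.
  by congr closed; apply/seteqP; split => B /=; rewrite add0r.
move=> B /= Bc i j.
have : sqmod (B i j) <= c.
  apply: le_trans Bc; rewrite /sqfrob (bigD1 i) //= (bigD1 j) //= -addrA lerDl.
  rewrite addr_ge0 // !sumr_ge0 // => *; rewrite ?sumr_ge0 // => *;
    exact: sqmod_ge0.
rewrite /sqmod !ler_norml; move: (complex.Re _) (complex.Im _) => a b {Bc} H.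
by split; apply/andP; split; nra.
Qed.

Lemma sqr_sum_le {R : realFieldType} {a b c d : R} :
  0 <= a -> 0 <= b -> a <= c -> b <= d -> a ^+ 2 + b ^+ 2 <= c ^+ 2 + d ^+ 2.
Proof. nra. Qed.

(** The scaling by [1 + d] sits inside a square, so a square root of [x - t ^+ 2] reduces this to
    [le_from_scaled]. *)
Lemma le_sqr_from_scaled {R : realType} {x s t : R} : 0 <= s ->
  (forall d, 0 < d -> x <= ((1 + d) * s) ^+ 2 + t ^+ 2) -> x <= s ^+ 2 + t ^+ 2.
Proof.
move=> s_ge0 lex; rewrite -lerBlDr.
have [le0|/ltW ge0] := leP (x - t ^+ 2) 0; first by rewrite (le_trans le0) ?sqr_ge0.
rewrite -(sqr_sqrtr ge0) lerXn2r ?nnegrE ?sqrtr_ge0 //.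
apply: le_from_scaled => // d d_gt0.
have ds_ge0 : 0 <= (1 + d) * s by rewrite mulr_ge0 // addr_ge0 // ltW.
by rewrite -[leRHS]ger0_norm // -sqrtr_sqr ler_wsqrtr // lerBlDr lex.
Qed.

Lemma parallelogram_bound {R : realFieldType} {u w a b c y : R} :
  u + w = 2 * (a + b) -> 0 <= u -> b <= c -> 0 <= y -> w <= 2 * (a + c) + y + 1.
Proof. lra. Qed.

Lemma radius_gt {R : realFieldType} (a b y : R) :
  0 <= a -> 0 <= b -> y < 2 * (a + b) + y + 1.
Proof. lra. Qed.

Lemma lexi_head_le {R : realFieldType} {x y : R} {P : Prop} :
  x < y \/ x = y /\ P -> x <= y.
Proof. by move=> [/ltW|[-> _]]. Qed.

Theorem theorem3p7 (R : realType) (m n : nat) (m_ge1 : (1 <= m)%N)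
    (n_ge1 : (1 <= n)%N) (mn2 : m = 2%N \/ n = 2%N)
    (A : 'M[R[i]]_(m, n)) (M : {vspace 'M[R[i]]_(m, n)})
    (Y : R -> 'M[R[i]]_(m, n)) (Yst : 'M[R[i]]_(m, n))
    (Y_cp : forall p : R, 1 < p -> cp_approx p A M (Y p))
    (Yst_strict : strict_spectral_approx A M Yst) :
  Y p @[p --> +oo] --> Yst.
Proof.
have mn_le2 : (minn m n <= 2)%N by case: mn2 => ->; rewrite ?geq_minl ?geq_minr.
have [YstM Yst_min] := Yst_strict.
(* If there is only one singular value, [t] is the default 0. *)
set s := (singvals (A - Yst))`_0; set t := (singvals (A - Yst))`_1.
have s_ge0 : 0 <= s by exact: singvals_ge0.
have YpM : \forall p \near +oo, Y p \in M.
  by near=> p; apply: (Y_cp _ _).1; near: p; exact: nbhs_pinfty_gt.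
have near_sv d : 0 < d -> \forall p \near +oo,
    (singvals (A - Y p))`_0 <= (1 + d) * s /\ (singvals (A - Y p))`_1 <= t.
  move=> d_gt0; near=> p.
  have p_gt1 : 1 < p by near: p; exact: nbhs_pinfty_gt.
  have [YM Ymin] := Y_cp p p_gt1.
  have s_min : s <= (singvals (A - Y p))`_0.
    exact: lexi_head_le (lexi_le2 _ _ _ mn_le2 (Yst_min _ YM)).
  have [] := schatten_le_singvals p _ _ mn_le2 (lt_trans ltr01 p_gt1)
    (Ymin _ YstM) s_min.
  move=> le_t le_s; split=> //.
  have powR_le : forall x y : R, 0 <= x -> 0 <= y ->
      x `^ p <= 2 * y `^ p -> x <= (1 + d) * y.
    by near: p; exact: near_powR_le.
  exact: powR_le (singvals_ge0 _ _) s_ge0 le_s.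
have near_sqfrob d : 0 < d -> \forall p \near +oo,
    sqfrob (A - Y p) <= ((1 + d) * s) ^+ 2 + t ^+ 2.
  move=> d_gt0; apply: filterS (near_sv d d_gt0) => p [les le_t].
  rewrite -(singvals2_sqfrob _ mn_le2).
  exact: sqr_sum_le (singvals_ge0 _ _) (singvals_ge0 _ _) les le_t.
have cluster_eq : cluster (Y p @[p --> +oo]) `<=` [set Yst].
  move=> Z; rewrite clusterE => ZY.
  (* A cluster point lies in every closed set that eventually contains [Y p]; all facts about [Z]
     are obtained this way. *)
  have in_closed (K : set 'M[R[i]]_(m, n)) :
      closed K -> (\forall p \near +oo, K (Y p)) -> K Z.
    by move=> Kcl KY; rewrite ((closure_id K).1 Kcl); exact: ZY.
  have ZM : Z \in M by apply: in_closed (closed_vspace _ _ M) YpM.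
  apply: (strict_spectral_approx_unique A M _ _ mn_le2 n_ge1 Yst_strict ZM).
    apply: le_from_scaled => // d d_gt0.
    have ds_ge0 : 0 <= (1 + d) * s by rewrite mulr_ge0 // addr_ge0 // ltW.
    apply/(singvals0_le _ _ n_ge1 ds_ge0) => x.
    have := in_closed _ (closed_sqfrob_affine_le (mulmxr x \o -%R) (A *m x)
      (((1 + d) * s) ^+ 2 * sqfrob x)).
    rewrite /= mulNmx -mulmxBl; apply.
    apply: filterS (near_sv d d_gt0) => p [les _]; rewrite mulNmx -mulmxBl.
    exact: (singvals0_le _ _ n_ge1 ds_ge0).1 les x.
  rewrite -(singvals2_sqfrob (A - Yst) mn_le2).
  apply: (le_sqr_from_scaled s_ge0) => d d_gt0.
  exact: in_closed _ (closed_sqfrob_sub_le _ _) (near_sqfrob d d_gt0).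
(* The first summand bounds [sqfrob (Y p)] for large [p], through the parallelogram law and
   [near_sqfrob] at [d = 1]; the other two put [Yst] in the interior of the ball. *)
pose c := 2 * (sqfrob A + (((1 + 1) * s) ^+ 2 + t ^+ 2)) + sqfrob Yst + 1.
pose V := [set B : 'M[R[i]]_(m, n) | sqfrob B <= c].
have cptV : compact V by exact: compact_sqfrob_le.
have nbhsV : nbhs Yst V.
  have Yst_lt : sqfrob Yst < c.
    by apply: radius_gt; rewrite ?addr_ge0 ?sqr_ge0 ?sqfrob_ge0.
  by apply: filterS (cvgr_lt _ (continuous_sqfrob Yst) _ Yst_lt) => B /ltW.
have YV : (Y p @[p --> +oo]) V.
  apply: filterS (near_sqfrob 1 ltr01) => p; rewrite /V /= => leF.
  have := sqfrob_parallelogram A (A - Y p); rewrite subKr => para.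
  exact: parallelogram_bound para (sqfrob_ge0 _) leF (sqfrob_ge0 _).
apply: (@compact_cluster_set1 _ Yst (Y p @[p --> +oo]) V
  (hausdorff_mx _ _) cptV nbhsV _ YV).
apply/seteqP; split=> // _ ->.
(* Compactness yields some cluster point, and it can only be [Yst]; so [Yst] is itself a cluster
   point. *)
have [Z [_ ZY]] := cptV _ _ YV.
by rewrite -(cluster_eq Z ZY).
Unshelve. all: by end_near.
Qed.
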